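(* Let $\psi:\mathbb{R}\to\mathbb{R}$ be Fock's function, i.e. the continuous extension to $\mathbb{R}$ of the function defined on rationals $\frac{p}{q}$ (in lowest terms, $q>0$) by $$\psi\left(\frac{p}{q}\right)=\frac{1}{q}\,\operatorname{arcosh}\left(\frac{3}{2}\,m\left(\frac{p}{q}\right)\right),$$ where $m\left(\frac{p}{q}\right)$ is the Markov number labelled by $\frac{p}{q}$. Then $\psi$ is differentiable at every irrational $x\in\mathbb{R}$ and is not differentiable at any rational $x\in\mathbb{R}$.
   Context: Markov triples are the positive integer solutions of $x^2+y^2+z^2=3xyz$. They are all obtained from $(1,1,1)$ by permutations and the Vieta involution $(x,y,z)\mapsto(x,y,3xy-z)$. Their entries are the Markov numbers. Labelling by rationals in $[0,\frac12]$ (Farey tree). Rationals are written in lowest terms with positive denominator. The mediant of $\frac{a}{b}$ and $\frac{c}{d}$ is $\frac{a}{b}\oplus\frac{c}{d}=\frac{a+c}{b+d}$. Every rational in $[0,\frac12]$ is obtained exactly once from $\frac01,\frac12$ by successively taking mediants of adjacent Farey fractions. The function $m$ on $\mathbb{Q}\cap[0,\frac12]$ is defined by $m(\frac01)=1$, $m(\frac12)=2$, $m(\frac13)=5$ and recursively along the Farey tree: if $L=\frac ab<R=\frac cd$ are Farey neighbours in $[0,\frac12]$ (that is, $bc-ad=1$) and $M=L\oplus R$, then $$m(L\oplus M)=3\,m(L)\,m(M)-m(R),\qquad m(M\oplus R)=3\,m(M)\,m(R)-m(L).$$ Thus $(m(L),m(M),m(R))$ is always a Markov triple (e.g. $m(\frac14)=13$,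 $m(\frac25)=29$). Extension to all rationals. The function $m$ is extended to all of $\mathbb{Q}$ (with $\infty=\frac10$ adjoined) by the symmetry $m(1-x)=m(1/x)=m(x)$. This is consistent, since $[0,\frac12]$ is a fundamental domain for the group generated by $x\mapsto 1-x$ and $x\mapsto 1/x$ acting on $\mathbb{R}\cup\{\infty\}$. By a theorem of Fock, the function $\psi$ defined on $\mathbb{Q}$ by the formula in the claim extends to a (necessarily unique) continuous convex function on all of $\mathbb{R}$. This extension is Fock's function $\psi$. *)

(* Defs.v *)
From HB Require Import structures.
From mathcomp Require Import all_boot all_order all_algebra.
From mathcomp Require Import all_classical all_reals all_analysis.
From mathcomp Require Import ring lra.

Set Implicit Arguments.
Unset Strict Implicit.
Unset Printing Implicit Defensive.

Import Order.TTheory GRing.Theory Num.Theory.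
Import numFieldNormedType.Exports.

Local Open Scope ring_scope.

(* The projective line over the rationals: [Some x] is the rational x and
   [None] is the point at infinity 1/0. *)
Definition projQ : Type := option rat.

Definition projQ_flip (x : projQ) : projQ :=
  if x is Some r then Some (1 - r) else None.

(* Since [0^-1 = 0] in [rat], the exchange of 0 and infinity is explicit. *)
Definition projQ_inv (x : projQ) : projQ :=
  if x is Some r then (if r == 0 then None else Some r^-1) else Some 0.

(* [denq] is positive and coprime to [numq], so for l = a/b and r = c/d in
   lowest terms the condition reads b c - a d = 1; it implies l < r. *)
Definition farey_neighbours (l r : rat) : Prop :=
  denq l * numq r - numq l * denq r = 1.

Definition mediant (l r : rat) : rat :=
  (numq l + numq r)%:~R / (denq l + denq r)%:~R.

(* Values are taken in [int] so that the subtractions are not truncated. *)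
Record markov_labelling (m : projQ -> int) : Prop := MarkovLabelling {
  markov_0 : m (Some 0) = 1;
  markov_half : m (Some (1 / 2)) = 2;
  markov_third : m (Some (1 / 3)) = 5;
  markov_left : forall l r : rat,
    0 <= l -> r <= 1 / 2 -> farey_neighbours l r ->
    m (Some (mediant l (mediant l r))) =
      3 * m (Some l) * m (Some (mediant l r)) - m (Some r);
  markov_right : forall l r : rat,
    0 <= l -> r <= 1 / 2 -> farey_neighbours l r ->
    m (Some (mediant (mediant l r) r)) =
      3 * m (Some (mediant l r)) * m (Some r) - m (Some l);
  markov_flip : forall x : projQ, m (projQ_flip x) = m x;
  markov_inv : forall x : projQ, m (projQ_inv x) = m x
}.

Definition arcosh (R : realType) (y : R) : R :=
  ln (y + Num.sqrt (y ^+ 2 - 1)).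

(* On [1, +oo[, [arcosh] is the nonnegative inverse of the hyperbolic cosine. *)
Lemma arcosh_ge0 (R : realType) (y : R) : 1 <= y -> 0 <= arcosh y.
Proof. by move=> y1; apply: ln_ge0; rewrite ler_wpDr ?sqrtr_ge0. Qed.

Lemma arcoshK (R : realType) (y : R) : 1 <= y ->
  (expR (arcosh y) + expR (- arcosh y)) / 2 = y.
Proof.
move=> y1; have s0 := sqrtr_ge0 (y ^+ 2 - 1).
have sE : Num.sqrt (y ^+ 2 - 1) ^+ 2 = y ^+ 2 - 1 by rewrite sqr_sqrtr //; nra.
rewrite /arcosh; set s := Num.sqrt _ in s0 sE *.
have ys0 : 0 < y + s by lra.
rewrite expRN lnK ?posrE //.
suff -> : (y + s)^-1 = y - s by field.
by apply: (mulfI (lt0r_neq0 ys0)); rewrite mulfV ?lt0r_neq0 // mulrC -subr_sqr sE; ring.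
Qed.

Definition fock_function (R : realType) (m : projQ -> int) (psi : R -> R) : Prop :=
  continuous psi /\
  forall r : rat,
    psi (ratr r) = arcosh (3 / 2 * (m (Some r))%:~R) / (denq r)%:~R.

(* Main.v *)
Require Import Defs.
From mathcomp Require Import all_boot all_order all_algebra.
From mathcomp Require Import all_classical all_reals all_analysis.
From mathcomp Require Import zify ring lra.

Import Order.TTheory GRing.Theory Num.Theory.
Import numFieldNormedType.Exports.

Local Open Scope ring_scope.

(** Put F(a, b) = b psi(a/b) = arcosh(3/2 m(a/b)) for a/b in lowest terms; psi is
the restriction of the homogeneous function F to the line b = 1.  The whole
argument rests on a closed form for F on the neighbours of a fixed rational.

Fix a vector A and a second basis vector B of Z^2, and put x = 3 m(A) = 2 cosh h,
so that h = F(A).  The Vieta relation says that y_k = 3 m(B + k A) satisfies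
y_(k+2) = x y_(k+1) - y_k, and Markov's equation fixes the product of the two
coefficients of the solution: y_k = 2 c cosh(s + k h) with c = coth h > 1.  Hence
F(B + k A) >= |s + k h| + ln c, while h and s define a linear form l_A on R^2
with l_A(A) = h and l_A(B + k A) = s + k h ([arcosh_two_sided], [fan_slopes]).

- At a rational point A, the right neighbours lie above l_A by at least ln c and
  so do the left ones.  The chords from A to its neighbours thus have slopes at
  least sigma + delta on the right and at most sigma - delta on the left, where
  sigma is the slope of l_A on the line b = 1 and delta = b ln c; the neighbours
  accumulate at A, so psi has a kink there ([not_derivable_fan]).

- Between any two rationals r < t there is a chain of Farey neighbours, so the
  local inequalities add up to sigma_r <= slope(r, t) <= sigma_t
  ([slope_between]); this is the convexity of psi.  Moreover F exceeds l_A at a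
  neighbour other than 0/1 by at most 2 (c - 1) <= 4 / (9 m(A)^2 - 4), and
  m(a/b) >= b; hence sigma_R - sigma_L <= 1/b + 1/d for Farey neighbours
  L = a/b < R = c/d ([interior_slopes]).  An irrational x lies between Farey
  neighbours with both denominators arbitrarily large, and all the slopes of psi
  near x are then trapped in an interval of length tending to 0
  ([derivable_irrational_interior]).

This is carried out in [0, 1/2], where the recursion for m is given, and moved to
the whole line by psi(1 - x) = psi(x) and x psi(1/x) = psi(x)
([fundamental_domain]).  Only the end points 0 and 1/2 have neighbours outside
[0, 1/2]; their fans are mirror symmetric ([mirror_fan]). *)

(** * Farey neighbours in the interval from 0 to 1/2, and Markov triples *)

(** Since division by 0 gives 0, the value at b = 0 is m(0), which is also the
label of the point at infinity. *)
Definition markov_at (m : projQ -> int) (a b : int) : int :=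
  m (Some (a%:~R / b%:~R)).

(** Farey neighbours a/b < c/d in [0, 1/2].  Numerators and denominators are kept
separate, so that taking a mediant is adding vectors; coprimality follows from
the determinant. *)
Definition farey_half (a b c d : int) : Prop :=
  [/\ 0 <= a, 0 < b, 0 < d, 2 * c <= d & b * c - a * d = 1].

Definition interior_frac (a b : int) : Prop :=
  [/\ 0 < a, 2 * a < b & coprime `|a| `|b|].

Lemma coprime_of_det {u v a b : int} :
  u * a + v * b = 1 -> coprime `|a| `|b|.
Proof. by move=> uv; rewrite -coprimezE; apply/coprimezP; exists (u, v). Qed.

Lemma numq_frac {a b : int} : 0 < b -> coprime `|a| `|b| ->
  numq (a%:~R / b%:~R) = a /\ denq (a%:~R / b%:~R) = b.
Proof.
move=> b0 ab; rewrite coprimeq_num // coprimeq_den // gtr0_sg // mul1r.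
by rewrite gt_eqF // gtr0_norm.
Qed.

Lemma frac_le {a b c d : int} : 0 < b -> 0 < d ->
  (a%:~R / b%:~R <= c%:~R / d%:~R :> rat) = (a * d <= c * b).
Proof.
move=> b0 d0; rewrite ler_pdivrMr ?ltr0z // mulrAC ler_pdivlMr ?ltr0z //.
by rewrite -!intrM ler_int.
Qed.

Lemma mediant_frac {a b c d : int} : 0 < b -> 0 < d -> b * c - a * d = 1 ->
  mediant (a%:~R / b%:~R) (c%:~R / d%:~R) = (a + c)%:~R / (b + d)%:~R.
Proof.
move=> b0 d0 det.
have [na da] := @numq_frac a b b0 (@coprime_of_det (- d) c a b ltac:(lia)).
have [nc dc] := @numq_frac c d d0 (@coprime_of_det b (- a) c d ltac:(lia)).
by rewrite /mediant na da nc dc.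
Qed.

Lemma farey_neighbours_frac {a b c d : int} :
  0 < b -> 0 < d -> b * c - a * d = 1 ->
  farey_neighbours (a%:~R / b%:~R) (c%:~R / d%:~R).
Proof.
move=> b0 d0 det.
have [na da] := @numq_frac a b b0 (@coprime_of_det (- d) c a b ltac:(lia)).
have [nc dc] := @numq_frac c d d0 (@coprime_of_det b (- a) c d ltac:(lia)).
by rewrite /farey_neighbours na da nc dc.
Qed.

Lemma farey_half_bounds {a b c d : int} : farey_half a b c d ->
  0 <= a%:~R / b%:~R :> rat /\ c%:~R / d%:~R <= 1 / 2 :> rat.
Proof.
case=> a0 b0 d0 cd _; split; first by rewrite divr_ge0 ?ler0z // ltW.
by rewrite (@frac_le c d 1 2) //; lia.
Qed.

Lemma farey_half_left {a b c d : int} :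
  farey_half a b c d -> farey_half a b (a + c) (b + d).
Proof. by case=> a0 b0 d0 cd det; split; nia. Qed.

Lemma farey_half_right {a b c d : int} :
  farey_half a b c d -> farey_half (a + c) (b + d) c d.
Proof. by case=> a0 b0 d0 cd det; split; nia. Qed.

Lemma vieta_left {m : projQ -> int} {a b c d : int} :
  markov_labelling m -> farey_half a b c d ->
  markov_at m (a + (a + c)) (b + (b + d)) =
  3 * markov_at m a b * markov_at m (a + c) (b + d) - markov_at m c d.
Proof.
move=> hm abcd; have [l0 r2] := farey_half_bounds abcd.
have [a0 b0 d0 cd det] := abcd.
have := markov_left hm l0 r2 (farey_neighbours_frac b0 d0 det).
by rewrite !mediant_frac //; lia.
Qed.

Lemma vieta_right {m : projQ -> int} {a b c d : int} :
  markov_labelling m -> farey_half a b c d ->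
  markov_at m (a + c + c) (b + d + d) =
  3 * markov_at m (a + c) (b + d) * markov_at m c d - markov_at m a b.
Proof.
move=> hm abcd; have [l0 r2] := farey_half_bounds abcd.
have [a0 b0 d0 cd det] := abcd.
have := markov_right hm l0 r2 (farey_neighbours_frac b0 d0 det).
by rewrite !mediant_frac //; lia.
Qed.

(** Every pair of neighbours is reached from (0/1, 1/2) by inserting mediants: the
end with the larger denominator is the mediant of the other end and of the
difference of the two vectors.  The only point to check is that this difference
stays in [0, 1/2], which fails for the root alone. *)
Lemma farey_half_ind (P : int -> int -> int -> int -> Prop) :
  P 0 1 1 2 ->
  (forall a b c d, farey_half a b c d -> P a b c d ->
     P a b (a + c) (b + d) /\ P (a + c) (b + d) c d) ->
  forall a b c d, farey_half a b c d -> P a b c d.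
Proof.
move=> P0 PS a b c d; have [n] : exists n : nat, b + d <= n%:Z.
  by exists (absz (b + d)); lia.
elim: n a b c d => [|n IHn] a b c d bdn [a0 b0 d0 cd det]; first lia.
have c1 : 1 <= c by nia.
have [bd|db|bd] := ltgtP b d.
(* with e = d - 2 c and f = b - 2 a, the determinant is f c - a e *)
- have [[-> [-> [-> ->]]] //|ne] : (a = 0 /\ b = 1 /\ c = 1 /\ d = 2) \/
      2 * (c - a) <= d - b.
    have [|lt] := leP (2 * (c - a)) (d - b); [by right|left].
    have ca : a < c by lia.
    have e0 : 0 <= (d - 2 * c) * (c - a) by nia.
    have fc : (d - 2 * c + 1) * c <= (b - 2 * a) * c by nia.
    have ce : (d - 2 * c) * (c - a) + c <= 1 by nia.
    have [{}c1 {}a0] : c = 1 /\ a = 0 by lia.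
    by subst; lia.
  have [] := PS a b (c - a) (d - b); [by split; nia|by apply: IHn; [lia|split; nia]|].
  by rewrite !subrKC.
- have a1 : 1 <= a by nia.
  have ca : c <= a by nia.
  have [] := PS (a - c) (b - d) c d; [by split; nia|by apply: IHn; [lia|split; nia]|].
  by rewrite !subrK.
- have e1 : d * (c - a) = 1 by lia.
  have ca : 1 <= c - a by nia.
  by nia.
Qed.

(** The recursion is a Vieta step, so it preserves Markov's equation.  The bounds
are carried along because m >= 1 turns z' = 3 x z - y into z' >= x + z, and this
additive growth is also what makes m dominate the denominator. *)
Lemma markov_triple {m : projQ -> int} {a b c d : int} :
  markov_labelling m -> farey_half a b c d ->
  let x := markov_at m a b in let y := markov_at m c d in
  let z := markov_at m (a + c) (b + d) in
  [/\ b <= x, d <= y, x + y <= z &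
      x ^+ 2 + y ^+ 2 + z ^+ 2 = 3 * x * y * z].
Proof.
move=> hm; move: a b c d; apply: farey_half_ind => [|a b c d abcd /=].
  rewrite /markov_at.
  have -> : (0 + 1)%:~R / (1 + 2)%:~R = 1 / 3 :> rat by [].
  have -> : 0%:~R / 1%:~R = 0 :> rat by rewrite mul0r.
  by rewrite (markov_0 hm) (markov_half hm) (markov_third hm).
have [a0 b0 d0 cd det] := abcd.
have := vieta_left hm abcd; have := vieta_right hm abcd.
rewrite -!addrA.
set x := markov_at m a b; set y := markov_at m c d.
set z := markov_at m (a + c) (b + d).
move=> -> -> [bx dy xyz e].
have xz1 : z <= x * z by nia.
have yz1 : z <= z * y by nia.
split; split; [lia|lia|lia| |lia|lia|lia|].
- by lra.
- by lra.
Qed.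

(** The parents of a/b: c/d is the right neighbour with the smallest denominator,
found by reducing a Bezout coefficient modulo b. *)
Lemma farey_parents {a b : int} : interior_frac a b ->
  exists c d : int, [/\ farey_half (a - c) (b - d) c d, farey_half a b c d &
                  farey_half (a - c) (b - d) a b].
Proof.
case=> a0 ab cab; have b0 : 0 < b by lia.
have [c [d [d0 db det]]] : exists c d : int, [/\ 0 <= d, d < b & b * c - a * d = 1].
  have [u [v uv]] := Bezoutz b a.
  have {}uv : u * b + v * a = 1.
    by rewrite uv; apply/eqP; rewrite gcdzC; move: cab; rewrite -coprimezE.
  exists (u - a * (- v %/ b)%Z), (- v %% b)%Z.
  have vE := divz_eq (- v) b.
  split; [by rewrite modz_ge0 // gt_eqF|by rewrite ltz_pmod|].
  have -> : (- v %% b)%Z = - v - (- v %/ b)%Z * b by apply/esym/eqP; rewrite subr_eq addrC -vE.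
  by rewrite -uv; ring.
exists c, d.
have d1 : 0 < d.
  rewrite lt_neqAle d0 andbT; apply/eqP => e0; rewrite -e0 in det.
  have c0 : 0 < c by nia.
  by nia.
have ca : c <= a by nia.
have cd : 2 * c <= d by nia.
by split; split; nia.
Qed.

Lemma det1_diff {a b c d c' d' : int} : 0 < b ->
  b * c - a * d = 1 -> b * c' - a * d' = 1 ->
  exists k : int, c' = c + k * a /\ d' = d + k * b.
Proof.
move=> b0 e e'.
have E : d' - d = (c * d' - c' * d) * b.
  have -> : d' - d = d' * (b * c - a * d) - d * (b * c' - a * d').
    by rewrite e e'; ring.
  by ring.
exists (c * d' - c' * d); split; last by rewrite -E; ring.
apply: (mulfI (lt0r_neq0 b0)).
have -> : b * c' = 1 + a * (d + (d' - d)) by rewrite -e'; ring.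
by rewrite E -e; ring.
Qed.

Lemma right_neighbour {a b c d c' d' : int} : d <= b ->
  farey_half a b c d -> farey_half a b c' d' ->
  exists k : nat, c' = c + k%:Z * a /\ d' = d + k%:Z * b.
Proof.
move=> db [a0 b0 d0 cd det] [_ _ d0' cd' det'].
have [k [cE dE]] := det1_diff b0 det det'.
have k0 : 0 <= k.
  by rewrite leNgt; apply/negP => k0; (have : k * b <= - b by nia); lia.
by exists `|k|%N; rewrite gez0_abs.
Qed.

Lemma left_neighbour {a b c d c' d' : int} : d <= b ->
  farey_half c d a b -> farey_half c' d' a b ->
  exists k : nat, c' = c + k%:Z * a /\ d' = d + k%:Z * b.
Proof.
move=> db [a0 b0 d0 cd det] [_ d0' _ cd' det'].
have [k [cE dE]] := @det1_diff a b (- c) (- d) (- c') (- d') d0 ltac:(lia) ltac:(lia).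
have k0 : 0 <= - k.
  by rewrite leNgt; apply/negP => k0; (have : - k * b <= - b by nia); lia.
by exists `|(- k)|%N; rewrite gez0_abs //; split; lia.
Qed.

(** * The inverse hyperbolic cosine along a two-sided recurrence *)

(** E + 1/E = 2 cosh (ln E) increases with |ln E|, and F may lie below 1. *)
Lemma joukowski_le {R : realType} {E F : R} : 0 < F -> 1 <= E ->
  F + F^-1 <= E + E^-1 -> F <= E.
Proof.
move=> F0 E1 FE; have [//|EF] := leP F E.
have E0 : 0 < E by lra.
suff : E + E^-1 < F + F^-1 by lra.
rewrite -subr_gt0.
have -> : F + F^-1 - (E + E^-1) = (F - E) * (F * E - 1) / (F * E).
  by field; rewrite !gt_eqF.
by rewrite divr_gt0 ?mulr_gt0 //; nra.
Qed.

(** The next two lemmas compare E = exp F with W = exp w when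
cosh F = c cosh w: multiplying cosh w by c > 1 moves w by at least ln c, and by
at most 2 (c - 1) as soon as w >= ln 2. *)
Lemma joukowski_scaled_ge {R : realType} {c E W : R} : 1 < c -> 0 < W -> 1 <= E ->
  E + E^-1 = c * (W + W^-1) -> c * W <= E.
Proof.
move=> c1 W0 E1 EW; have c0 : 0 < c by lra.
apply: joukowski_le => //; first exact: mulr_gt0.
rewrite EW mulrDr lerD2l invfM ler_wpM2r ?invr_ge0 ?ltW //.
by rewrite (@lt_trans _ _ 1) ?invf_lt1.
Qed.

Lemma joukowski_scaled_le {R : realType} {c E W : R} : 1 < c -> 2 <= W -> 1 <= E ->
  E + E^-1 = c * (W + W^-1) -> E / W - 1 <= 2 * (c - 1).
Proof.
move=> c1 W2 E1 EW; have W0 : 0 < W by lra.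
have WE : c * W <= E by apply: joukowski_scaled_ge.
have {}WE : W <= E by apply: le_trans WE; rewrite ler_peMl // ltW.
have E0 : 0 < E by lra.
have key : (E - W) * (E * W - 1) = (c - 1) * (W ^+ 2 + 1) * E.
  have -> : (E - W) * (E * W - 1) = (E + E^-1 - (W + W^-1)) * (E * W).
    by field; rewrite !gt_eqF.
  by rewrite EW; field; rewrite !gt_eqF.
rewrite -(ler_pM2r W0) mulrBl divfK ?gt_eqF // mul1r.
rewrite -(ler_pM2r (_ : 0 < E * W - 1)); last by nra.
rewrite key.
have : (c - 1) * E * (W ^+ 2 + 1) <= (c - 1) * (2 * W * (E * W - 1)).
  rewrite -mulrA ler_pM2l ?subr_gt0 //.
  have W3 : 3 <= W ^+ 2 - 1 by nra.
  have : W * (W ^+ 2 - 1) <= E * (W ^+ 2 - 1) by rewrite ler_wpM2r //; lra.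
  by nra.
by lra.
Qed.

Lemma arcosh_exp {R : realType} {y : R} : 1 <= y ->
  let E := expR (arcosh y) in 1 <= E /\ E + E^-1 = 2 * y.
Proof.
move=> y1 E; split; first by rewrite /E -expR0 ler_expR arcosh_ge0.
have := arcoshK y1; rewrite expRN -/E; lra.
Qed.

Lemma recurrence_closed_form {R : realType} {x u c W : R} {p : nat -> R} :
  u != 0 -> W != 0 -> u + u^-1 = x ->
  p 0%N = c * (W + W^-1) -> p 1%N = c * (W * u + (W * u)^-1) ->
  (forall k, p k.+2 = x * p k.+1 - p k) ->
  forall k, p k = c * (W * u ^+ k + (W * u ^+ k)^-1).
Proof.
move=> u0 W0 ux p0 p1 pS k.
suff [] : p k = c * (W * u ^+ k + (W * u ^+ k)^-1) /\
  p k.+1 = c * (W * u ^+ k.+1 + (W * u ^+ k.+1)^-1) by [].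
elim: k => [|k [IH0 IH1]]; first by rewrite expr0 expr1 mulr1.
split=> //; rewrite pS IH0 IH1 -ux !exprS; field.
by rewrite u0 W0 expf_neq0.
Qed.

Lemma arcosh_bounds {R : realType} {c W y : R} : 1 < c -> 0 < W -> 1 <= y ->
  2 * y = c * (W + W^-1) ->
  ln W + ln c <= arcosh y /\ (2 <= W -> arcosh y <= ln W + 2 * (c - 1)).
Proof.
move=> c1 W0 y1 yE; have c0 : 0 < c by lra.
have [E1 EE] := arcosh_exp y1; rewrite yE in EE; split=> [|W2].
  rewrite addrC -lnM ?posrE // -[leRHS]expRK ler_ln ?posrE ?mulr_gt0 ?expR_gt0 //.
  exact: joukowski_scaled_ge EE.
rewrite addrC -lerBlDr; apply: le_trans (joukowski_scaled_le c1 W2 E1 EE).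
rewrite -{1}[arcosh y]expRK -ln_div ?posrE ?expR_gt0 //.
rewrite -[X in ln X](subrKC 1); apply: le_ln1Dx.
by rewrite ltrBDr addrC subrr divr_gt0 ?expR_gt0.
Qed.

(** The sequences p and q are the two halves of a single solution, read in opposite
directions from two consecutive terms p 0 and q 0.  Its two exponential
coefficients are c W and c / W, and the cubic equation says exactly that their
product is c^2 with c = x / (u - 1/u) = coth h.  The starting values s and t of
the linear parts add up to h because q 0 is the term of index -1 of p. *)
Lemma arcosh_two_sided {R : realType} {x : R} {p q : nat -> R} :
  3 <= x -> (forall k, 3 <= p k) -> (forall k, 3 <= q k) ->
  (forall k, p k.+2 = x * p k.+1 - p k) ->
  (forall k, q k.+2 = x * q k.+1 - q k) ->
  p 1%N = x * p 0%N - q 0%N -> q 1%N = x * q 0%N - p 0%N ->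
  x ^+ 2 + p 0%N ^+ 2 + q 0%N ^+ 2 = x * p 0%N * q 0%N ->
  let h := arcosh (x / 2) in
  exists s t delta : R, [/\ s + t = h, 0 < delta,
    forall k : nat, s + k%:R * h + delta <= arcosh (p k / 2),
    forall k : nat, t + k%:R * h + delta <= arcosh (q k / 2) &
    q 0%N <= p 1%N -> p 0%N <= q 1%N ->
      (forall k, 6 <= p k ->
         arcosh (p k / 2) <= s + k%:R * h + 4 / (x ^+ 2 - 4)) /\
      (forall k, 6 <= q k ->
         arcosh (q k / 2) <= t + k%:R * h + 4 / (x ^+ 2 - 4))].
Proof.
move=> x3 p3 q3 pS qS p1 q1 mk h.
have [u1 ux] := @arcosh_exp R (x / 2) ltac:(lra).
rewrite -/h mulrCA divff // mulr1 in u1 ux.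
set u := expR h in u1 ux.
have u0 : 0 < u by lra.
have {}u1 : 1 < u.
  rewrite lt_neqAle u1 andbT; apply/eqP => e1; move: ux; rewrite -e1 invr1; lra.
have uV1 : u^-1 < 1 by rewrite invf_lt1.
have uV0 : 0 < u^-1 by rewrite invr_gt0.
(* u + 1/u = x = 2 cosh h, hence c = coth h *)
pose c := x / (u - u^-1).
have uu0 : 0 < u - u^-1 by lra.
have c1 : 1 < c by rewrite /c ltr_pdivlMr // mul1r; lra.
have c0 : 0 < c by lra.
have x0 : 0 < x by lra.
(* p 0 = c (W + W') and p 1 = c (W u + W' / u), solved for W and W' *)
pose W := (p 1%N - p 0%N / u) / x; pose W' := (p 0%N * u - p 1%N) / x.
have x0' : x != 0 by rewrite gt_eqF.
have u0' : u != 0 by rewrite gt_eqF.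
have WW' : W * W' = 1.
  have -> : W * W' = (p 1%N * (p 0%N * (u + u^-1) - p 1%N) - p 0%N ^+ 2) / x ^+ 2.
    by rewrite /W /W'; field; rewrite x0' u0'.
  rewrite ux; have -> : p 0%N * x - p 1%N = q 0%N by lra.
  apply: (mulIf (expf_neq0 2 x0')); rewrite mul1r divfK ?expf_neq0 //.
  by rewrite p1; lra.
have Wsum : c * (W + W') = p 0%N.
  rewrite (_ : W + W' = p 0%N * (u - u^-1) / x).
    by rewrite /c; field; rewrite x0' u0' -expr2; nra.
  by rewrite /W /W'; field; rewrite x0' u0'.
have W0 : 0 < W.
  have s0 : 0 < W + W' by rewrite -(pmulr_rgt0 _ c0) Wsum; have := p3 0%N; lra.
  nra.
have W'E : W' = W^-1 by apply: (mulfI (lt0r_neq0 W0)); rewrite WW' mulfV ?gt_eqF.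
have {}pE k : p k = c * (W * u ^+ k + (W * u ^+ k)^-1).
  apply: recurrence_closed_form (lt0r_neq0 W0) ux _ _ pS k => //.
    by rewrite -Wsum W'E.
  rewrite invfM -W'E.
  have -> : W * u + W' * u^-1 = p 1%N * (u - u^-1) / x.
    by rewrite /W /W'; field; rewrite x0' u0'.
  by rewrite /c; field; rewrite x0' u0' -expr2; nra.
(* q 0 is the term of index -1, so q starts from W^-1 u *)
pose V := u / W.
have V0 : 0 < V by rewrite divr_gt0.
have pE0 : p 0%N = c * (W + W^-1) by rewrite pE expr0 mulr1.
have p1E : p 1%N = c * (W * u + (W * u)^-1) by rewrite pE expr1.
have q0E : q 0%N = (u + u^-1) * p 0%N - p 1%N by rewrite ux; lra.
have qE k : q k = c * (V * u ^+ k + (V * u ^+ k)^-1).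
  apply: recurrence_closed_form => //; rewrite ?gt_eqF //.
  - rewrite q0E pE0 p1E /V; field.
    by rewrite u0' gt_eqF.
  - rewrite q1 q0E pE0 p1E -ux /V; field.
    by rewrite u0' gt_eqF.
  - by move=> j; rewrite qS ux.
have lnXu Z (k : nat) : 0 < Z -> ln (Z * u ^+ k) = ln Z + k%:R * h.
  by move=> Z0; rewrite lnM ?posrE ?exprn_gt0 // lnXn // expRK mulr_natl.
have uk1 k : 1 <= u ^+ k by rewrite exprn_ege1 // ltW.
have c2 : c ^+ 2 - 1 = 4 / (x ^+ 2 - 4).
  rewrite /c -ux; field.
  have um : u * u - 1 != 0 by rewrite gt_eqF //; nra.
  have -> : (u * u + 1) ^+ 2 + -4 * u ^+ 2 = (u * u - 1) ^+ 2 by ring.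
  by rewrite u0' um expf_neq0.
have gap : 2 * (c - 1) <= 4 / (x ^+ 2 - 4).
  rewrite -c2; nra.
have c32 : c <= 3 / 2.
  have : 4 / (x ^+ 2 - 4) <= 4 / 5 by rewrite ler_pM2l // lef_pV2 ?posrE; nra.
  by rewrite -c2; nra.
have big Z (k : nat) : 1 <= Z -> 6 <= c * (Z * u ^+ k + (Z * u ^+ k)^-1) -> 2 <= Z * u ^+ k.
  move=> Z1; have := uk1 k; set T := Z * u ^+ k => uk.
  have T1 : 1 <= T by rewrite /T -[1]mulr1 ler_pM.
  have TV : T^-1 <= 1 by rewrite invf_le1 //; lra.
  have T0 : 0 < T^-1 by rewrite invr_gt0; lra.
  by nra.
exists (ln W), (ln V), (ln c); split.
- by rewrite /V ln_div ?posrE // expRK; ring.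
- exact: ln_gt0.
- move=> k; rewrite -lnXu //; apply: (arcosh_bounds c1 _ _ _).1.
  + by rewrite mulr_gt0 ?exprn_gt0.
  + by have := p3 k; lra.
  + by rewrite -pE; lra.
- move=> k; rewrite -lnXu //; apply: (arcosh_bounds c1 _ _ _).1.
  + by rewrite mulr_gt0 ?exprn_gt0.
  + by have := q3 k; lra.
  + by rewrite -qE; lra.
move=> qp pq.
(* q 0 <= p 1 compares the terms of index -1 and 1, which decides the sign of ln W *)
have W1 : 1 <= W.
  have WV1 : 0 <= c * ((u - u^-1) * (W - W^-1)).
    have := qp; rewrite pE qE expr0 expr1 mulr1 -subr_ge0.
    by congr (0 <= _); rewrite /V; field; rewrite u0' gt_eqF.
  move: WV1; rewrite pmulr_rge0 // pmulr_rge0 // subr_ge0 => WV1.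
  have : W^-1 * W = 1 by rewrite mulVf ?gt_eqF.
  by nra.
have V1 : 1 <= V.
  have WV1 : 0 <= c * ((u - u^-1) * (V - V^-1)).
    have := pq; rewrite pE qE expr0 expr1 mulr1 -subr_ge0.
    by congr (0 <= _); rewrite /V; field; rewrite u0' gt_eqF.
  move: WV1; rewrite pmulr_rge0 // pmulr_rge0 // subr_ge0 => WV1.
  have : V^-1 * V = 1 by rewrite mulVf ?gt_eqF.
  by nra.
split=> k k6; rewrite -lnXu //.
- apply: le_trans (_ : _ <= ln (W * u ^+ k) + 2 * (c - 1)) _; last by rewrite lerD2l.
  apply: (arcosh_bounds c1 _ _ _).2.
  + by rewrite mulr_gt0 ?exprn_gt0.
  + by have := p3 k; lra.
  + by rewrite -pE; lra.
  + by apply: big => //; rewrite -pE.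
- apply: le_trans (_ : _ <= ln (V * u ^+ k) + 2 * (c - 1)) _; last by rewrite lerD2l.
  apply: (arcosh_bounds c1 _ _ _).2.
  + by rewrite mulr_gt0 ?exprn_gt0.
  + by have := q3 k; lra.
  + by rewrite -qE; lra.
  + by apply: big => //; rewrite -qE.
Qed.

(** * The fan of neighbours of a rational *)

(** b psi(a/b): half the length of the closed geodesic of class (a, b) on the
modular torus. *)
Definition fock_at (R : realType) (m : projQ -> int) (a b : int) : R :=
  arcosh (3 / 2 * (markov_at m a b)%:~R).

(** The slope of psi between a/b and c/d, multiplied by the determinant b c - a d;
for Farey neighbours it is the slope itself. *)
Definition edge_slope (R : realType) (m : projQ -> int) (a b c d : int) : R :=
  b%:~R * fock_at R m c d - d%:~R * fock_at R m a b.

(** When 0 < d <= b, the vectors (c + k a, d + k b) and (a - c + k a, b - d + k b),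
for k >= 0, point to the right and left neighbours of a/b.  Together they form one sequence
invariant under adding (a, b), up to the sign of the vectors; the two turn
conditions are the recurrence at the place where the two halves meet. *)
Record markov_fan (m : projQ -> int) (a b c d : int) : Prop := MarkovFan {
  fan_den : 0 < b;
  fan_det : b * c - a * d = 1;
  fan_centre : 1 <= markov_at m a b;
  fan_right_ge1 : forall k : nat, 1 <= markov_at m (c + k%:Z * a) (d + k%:Z * b);
  fan_left_ge1 : forall k : nat,
    1 <= markov_at m (a - c + k%:Z * a) (b - d + k%:Z * b);
  fan_right_step : forall k : nat,
    markov_at m (c + k.+2%:Z * a) (d + k.+2%:Z * b) =
    3 * markov_at m a b * markov_at m (c + k.+1%:Z * a) (d + k.+1%:Z * b)
    - markov_at m (c + k%:Z * a) (d + k%:Z * b);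
  fan_left_step : forall k : nat,
    markov_at m (a - c + k.+2%:Z * a) (b - d + k.+2%:Z * b) =
    3 * markov_at m a b * markov_at m (a - c + k.+1%:Z * a) (b - d + k.+1%:Z * b)
    - markov_at m (a - c + k%:Z * a) (b - d + k%:Z * b);
  fan_right_turn :
    markov_at m (c + a) (d + b) =
    3 * markov_at m a b * markov_at m c d - markov_at m (a - c) (b - d);
  fan_left_turn :
    markov_at m (a - c + a) (b - d + b) =
    3 * markov_at m a b * markov_at m (a - c) (b - d) - markov_at m c d;
  fan_triple :
    markov_at m a b ^+ 2 + markov_at m (a - c) (b - d) ^+ 2 + markov_at m c d ^+ 2 =
    3 * markov_at m a b * markov_at m (a - c) (b - d) * markov_at m c d
}.

(** With s and t from [arcosh_two_sided], the linear form equal to [fock_at] at (a, b)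
and to t at (c, d) takes the value s at (a - c, b - d); the bounds along the two
halves say that it supports [fock_at] from below, sigma being its slope.  The last
clause bounds the gap from above, provided that the values of m grow along both
halves from the start. *)
Lemma fan_slopes {R : realType} {m : projQ -> int} {a b c d : int} :
  markov_fan m a b c d -> exists sigma delta : R, [/\ 0 < delta,
    forall k : nat,
      sigma + delta <= edge_slope R m a b (c + k%:Z * a) (d + k%:Z * b),
    forall k : nat,
      edge_slope R m (a - c + k%:Z * a) (b - d + k%:Z * b) a b <= sigma - delta &
    markov_at m c d <= markov_at m (a - c + a) (b - d + b) ->
    markov_at m (a - c) (b - d) <= markov_at m (c + a) (d + b) ->
    let eps := b%:~R * (4 / (9 * (markov_at m a b)%:~R ^+ 2 - 4)) in
    (forall k : nat, 2 <= markov_at m (c + k%:Z * a) (d + k%:Z * b) ->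
      edge_slope R m a b (c + k%:Z * a) (d + k%:Z * b) <= sigma + eps) /\
    (forall k : nat, 2 <= markov_at m (a - c + k%:Z * a) (b - d + k%:Z * b) ->
      sigma - eps <= edge_slope R m (a - c + k%:Z * a) (b - d + k%:Z * b) a b)].
Proof.
case=> b0 det x1 q1 p1 qS pS qT pT tri.
pose x : R := 3 * (markov_at m a b)%:~R.
pose q (k : nat) : R := 3 * (markov_at m (c + k%:Z * a) (d + k%:Z * b))%:~R.
pose p (k : nat) : R :=
  3 * (markov_at m (a - c + k%:Z * a) (b - d + k%:Z * b))%:~R.
have ge3 (n : int) : 1 <= n -> 3 <= 3 * n%:~R :> R.
  by move=> n1; rewrite -[leLHS]mulr1 ler_pM2l // ler1z.
have ge6 (n : int) : 2 <= n -> 6 <= 3 * n%:~R :> R.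
  by rewrite -(ler_int R) => n2; lra.
have castE (u v w t : int) : u = 3 * v * w - t ->
    3 * u%:~R = 3 * v%:~R * (3 * w%:~R) - 3 * t%:~R :> R.
  by move=> ->; rewrite intrB !intrM; ring.
have x3 : 3 <= x by exact: ge3.
have fE (u v : int) : arcosh (3 * (markov_at m u v)%:~R / 2) = fock_at R m u v.
  by rewrite /fock_at mulrAC.
have p0E : p 0%N = 3 * (markov_at m (a - c) (b - d))%:~R.
  by rewrite /p !mul0r !addr0.
have q0E : q 0%N = 3 * (markov_at m c d)%:~R by rewrite /q !mul0r !addr0.
have p1E : p 1%N = 3 * (markov_at m (a - c + a) (b - d + b))%:~R.
  by rewrite /p !mul1r.
have q1E : q 1%N = 3 * (markov_at m (c + a) (d + b))%:~R by rewrite /q !mul1r.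
have p3 k : 3 <= p k by exact/ge3/p1.
have q3 k : 3 <= q k by exact/ge3/q1.
have pS' k : p k.+2 = x * p k.+1 - p k by exact: castE (pS k).
have qS' k : q k.+2 = x * q k.+1 - q k by exact: castE (qS k).
have pT' : p 1%N = x * p 0%N - q 0%N by rewrite p1E p0E q0E; apply: castE.
have qT' : q 1%N = x * q 0%N - p 0%N by rewrite q1E p0E q0E; apply: castE.
have tri' : x ^+ 2 + p 0%N ^+ 2 + q 0%N ^+ 2 = x * p 0%N * q 0%N.
  move: (congr1 (fun n : int => n%:~R : R) tri).
  rewrite p0E q0E /x !rmorphD !rmorphXn !rmorphM /=; lra.
have [s [t [delta [st delta0 sp tq gap]]]] :=
  arcosh_two_sided x3 p3 q3 pS' qS' pT' qT' tri'.
have b0R : 0 < b%:~R :> R by rewrite ltr0z.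
rewrite /x fE in st sp tq gap.
set h := fock_at R m a b in st sp tq gap *.
(* the linear form equal to h at (a, b) and to t at (c, d) has slope sigma *)
exists (b%:~R * t - d%:~R * h), (b%:~R * delta); split.
- exact: mulr_gt0.
- move=> k; have := tq k; rewrite /q fE -(ler_pM2l b0R) => {}tq.
  by rewrite /edge_slope -/h !intrD !intrM; lra.
- move=> k; have := sp k; rewrite /p fE -(ler_pM2l b0R) => {}sp.
  by rewrite /edge_slope -/h !(intrD, intrM, mulrNz) -st; rewrite -st in sp; lra.
move=> qp pq eps.
rewrite p1E q0E q1E p0E !ler_pM2l // !ler_int in gap.
have xE : (3 * (markov_at m a b)%:~R) ^+ 2 = 9 * (markov_at m a b)%:~R ^+ 2 :> R.
  by ring.
have [pg qg] := gap qp pq; rewrite xE in pg qg; split=> k k2.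
- have {}qg : b%:~R * fock_at R m (c + k%:Z * a) (d + k%:Z * b) <=
      b%:~R * (t + k%:R * h + 4 / (9 * (markov_at m a b)%:~R ^+ 2 - 4)).
    by rewrite ler_pM2l // -fE; apply: qg; apply: ge6.
  by rewrite /edge_slope -/h !(intrD, intrM, mulrNz) /eps; lra.
- have {}pg : b%:~R * fock_at R m (a - c + k%:Z * a) (b - d + k%:Z * b) <=
      b%:~R * (s + k%:R * h + 4 / (9 * (markov_at m a b)%:~R ^+ 2 - 4)).
    by rewrite ler_pM2l // -fE; apply: pg; apply: ge6.
  by rewrite /edge_slope -/h !(intrD, intrM, mulrNz) /eps -st; rewrite -st in pg; lra.
Qed.

Lemma farey_half_right_fan {a b c d : int} (k : nat) : farey_half a b c d ->
  farey_half a b (c + k%:Z * a) (d + k%:Z * b).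
Proof.
move=> abcd; elim: k => [|k /farey_half_left]; first by rewrite !mul0r !addr0.
congr farey_half; lia.
Qed.

Lemma farey_half_left_fan {a b c d : int} (k : nat) : farey_half c d a b ->
  farey_half (c + k%:Z * a) (d + k%:Z * b) a b.
Proof.
move=> abcd; elim: k => [|k /farey_half_right]; first by rewrite !mul0r !addr0.
congr farey_half; lia.
Qed.

Lemma markov_right_fan {m : projQ -> int} {a b c d : int} (k : nat) :
  markov_labelling m -> farey_half a b c d ->
  markov_at m (c + k.+2%:Z * a) (d + k.+2%:Z * b) =
    3 * markov_at m a b * markov_at m (c + k.+1%:Z * a) (d + k.+1%:Z * b)
    - markov_at m (c + k%:Z * a) (d + k%:Z * b).
Proof.
move=> hm /(farey_half_right_fan k) /(vieta_left hm).
by congr (markov_at _ _ _ = _ * markov_at _ _ _ - _); lia.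
Qed.

Lemma markov_left_fan {m : projQ -> int} {a b c d : int} (k : nat) :
  markov_labelling m -> farey_half c d a b ->
  markov_at m (c + k.+2%:Z * a) (d + k.+2%:Z * b) =
    3 * markov_at m a b * markov_at m (c + k.+1%:Z * a) (d + k.+1%:Z * b)
    - markov_at m (c + k%:Z * a) (d + k%:Z * b).
Proof.
move=> hm /(farey_half_left_fan k) /(vieta_right hm).
rewrite [3 * _ * markov_at m a b]mulrAC.
by congr (markov_at _ _ _ = _ * markov_at _ _ _ - _); lia.
Qed.

Lemma markov_ge_den {m : projQ -> int} {a b c d : int} :
  markov_labelling m -> farey_half a b c d ->
  b <= markov_at m a b /\ d <= markov_at m c d.
Proof. by move=> hm /(markov_triple hm) []. Qed.

Lemma interior_fan {m : projQ -> int} {a b c d : int} : markov_labelling m ->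
  farey_half (a - c) (b - d) c d -> farey_half a b c d ->
  farey_half (a - c) (b - d) a b -> markov_fan m a b c d.
Proof.
move=> hm LR AR LA; have [a0 b0 d0 cd det] := AR.
have [_ bd0 _ _ _] := LA.
have tri := markov_triple hm LR; rewrite /= !subrK in tri.
case: tri => gL gR gA e.
split=> //; rewrite ?subrK.
- lia.
- move=> k; have [] := markov_ge_den hm (farey_half_right_fan k AR); nia.
- move=> k; have [] := markov_ge_den hm (farey_half_left_fan k LA); nia.
- by move=> k; apply: markov_right_fan.
- by move=> k; apply: markov_left_fan.
- have := vieta_right hm LR; rewrite !subrK.
  by rewrite [c + a]addrC [d + b]addrC => ->.
- have := vieta_left hm LR; rewrite !subrK => ->.
  by rewrite [3 * _ * markov_at m a b]mulrAC.
- lra.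
Qed.

(** The first two clauses are the subgradient inequality for psi at a/b, tested on
the neighbours of a/b; the last two say that it is nearly an equality there.  The
condition 2 <= d leaves out the neighbour 0/1, whose label 1 is too small for the
estimate. *)
Definition supporting_slope {R : realType} (m : projQ -> int) (a b : int) (s : R) :=
  [/\ forall c d, farey_half a b c d -> s <= edge_slope R m a b c d,
    forall c d, farey_half c d a b -> edge_slope R m c d a b <= s,
    forall c d, farey_half a b c d -> 2 <= d ->
      edge_slope R m a b c d <= s + b%:~R^-1 &
    forall c d, farey_half c d a b -> 2 <= d ->
      s - b%:~R^-1 <= edge_slope R m c d a b].

Lemma interior_slopes {R : realType} {m : projQ -> int} {a b : int} :
  markov_labelling m -> interior_frac a b ->
  exists s : R, supporting_slope m a b s.
Proof.
move=> hm iab; have [c [d [LR AR LA]]] := farey_parents iab.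
have [_ d1 d0 _ _] := LR; have [_ b0 _ _ _] := AR.
have [sigma [delta [delta0 Rs Ls bnd]]] := fan_slopes (R := R) (interior_fan hm LR AR LA).
have Rn c' d' : farey_half a b c' d' ->
    exists k : nat, c' = c + k%:Z * a /\ d' = d + k%:Z * b.
  by apply: right_neighbour => //; lia.
have Ln c' d' : farey_half c' d' a b ->
    exists k : nat, c' = a - c + k%:Z * a /\ d' = b - d + k%:Z * b.
  by apply: left_neighbour => //; lia.
have [bA _] := markov_ge_den hm AR.
have [pq qp] : markov_at m c d <= markov_at m (a - c + a) (b - d + b) /\
    markov_at m (a - c) (b - d) <= markov_at m (c + a) (d + b).
  have [_ _ gLA _] := markov_triple hm LA.
  have [_ dR gAR _] := markov_triple hm AR.
  have [bL _ gLR _] := markov_triple hm LR.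
  rewrite !subrK in gLR; rewrite [c + a]addrC [d + b]addrC.
  have mR0 : 0 <= markov_at m c d by apply: le_trans dR; apply: ltW.
  have mL0 : 0 <= markov_at m (a - c) (b - d) by apply: le_trans bL; apply: ltW.
  split; [apply: le_trans gLA|apply: le_trans gAR].
    by apply: ler_wpDl => //; apply: le_trans gLR; apply: ler_wpDl.
  by apply: ler_wpDr => //; apply: le_trans gLR; apply: ler_wpDr.
have {bnd} [Rb Lb] := bnd pq qp.
have eps : b%:~R * (4 / (9 * (markov_at m a b)%:~R ^+ 2 - 4)) <= b%:~R^-1 :> R.
  have b1 : 1 <= b%:~R :> R by rewrite ler1z; lia.
  have bAR : b%:~R <= (markov_at m a b)%:~R :> R by rewrite ler_int.
  have b0R : 0 < b%:~R :> R by rewrite ltr0z.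
  rewrite -(ler_pM2l b0R) mulfV ?gt_eqF //.
  by rewrite !mulrA ler_pdivrMr; nra.
exists sigma; split.
- by move=> c' d' /Rn [k [-> ->]]; apply: le_trans (Rs k); rewrite lerDl ltW.
- by move=> c' d' /Ln [k [-> ->]]; apply: le_trans (Ls k) _; rewrite gerBl ltW.
- move=> c' d' AR' d2; have [_ dm] := markov_ge_den hm AR'.
  have [k [cE dE]] := Rn _ _ AR'; rewrite cE dE; apply: le_trans (Rb k _) _.
    by rewrite -cE -dE; lia.
  by rewrite lerD2l.
- move=> c' d' LA' d2; have [dm _] := markov_ge_den hm LA'.
  have [k [cE dE]] := Ln _ _ LA'; rewrite cE dE; apply: le_trans (Lb k _).
    by rewrite lerD2l lerN2.
  by rewrite -cE -dE; lia.
Qed.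

Lemma markov_at_flip {m : projQ -> int} {a b : int} :
  markov_labelling m -> b != 0 -> markov_at m (b - a) b = markov_at m a b.
Proof.
move=> hm b0; have := markov_flip hm (Some (a%:~R / b%:~R)).
by rewrite /projQ_flip /markov_at => <-; rewrite intrB mulrBl divff // intr_eq0.
Qed.

Lemma markov_at_inv {m : projQ -> int} {a b : int} :
  markov_labelling m -> a != 0 -> b != 0 -> markov_at m b a = markov_at m a b.
Proof.
move=> hm a0 b0; have := markov_inv hm (Some (a%:~R / b%:~R)).
rewrite /projQ_inv /markov_at => <-.
by rewrite mulf_eq0 invr_eq0 !intr_eq0 (negPf a0) (negPf b0) orbF invf_div.
Qed.

(** At the fixed points of the symmetries of m the two halves of the fan carry the
same labels. *)
Lemma mirror_fan {m : projQ -> int} {a b c d : int} (h : nat -> int) :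
  0 < b -> b * c - a * d = 1 -> 1 <= markov_at m a b ->
  (forall k : nat, markov_at m (c + k%:Z * a) (d + k%:Z * b) = h k) ->
  (forall k : nat, markov_at m (a - c + k%:Z * a) (b - d + k%:Z * b) = h k) ->
  (forall k, 1 <= h k) ->
  (forall k, h k.+2 = 3 * markov_at m a b * h k.+1 - h k) ->
  h 1%N = 3 * markov_at m a b * h 0%N - h 0%N ->
  markov_at m a b ^+ 2 + h 0%N ^+ 2 + h 0%N ^+ 2 = 3 * markov_at m a b * h 0%N * h 0%N ->
  markov_fan m a b c d.
Proof.
move=> b0 det g1 R L h1 hS hT tri.
have := R 0%N; rewrite !mul0r !addr0 => R0.
have := L 0%N; rewrite !mul0r !addr0 => L0.
have := R 1%N; rewrite !mul1r => R1.
have := L 1%N; rewrite !mul1r => L1.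
by split=> // [k|k|k|k| | |]; rewrite ?R ?L ?R0 ?L0 ?R1 ?L1.
Qed.

Lemma markov_at_zero {m : projQ -> int} :
  markov_labelling m -> markov_at m 0 1 = 1.
Proof. by move=> hm; rewrite /markov_at mul0r (markov_0 hm). Qed.

Lemma markov_at_one {m : projQ -> int} :
  markov_labelling m -> markov_at m 1 1 = 1.
Proof. by move=> hm; have := @markov_at_flip m 0 1 hm isT; rewrite subr0 markov_at_zero. Qed.

Lemma markov_at_half {m : projQ -> int} :
  markov_labelling m -> markov_at m 1 2 = 2.
Proof. by move=> hm; rewrite /markov_at -[RHS](markov_half hm). Qed.

Lemma markov_at_third {m : projQ -> int} :
  markov_labelling m -> markov_at m 1 3 = 5.
Proof. by move=> hm; rewrite /markov_at -[RHS](markov_third hm). Qed.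

Lemma farey_half_root : farey_half 0 1 1 2.
Proof. by []. Qed.

(** The left neighbours -1/k of 0 have the labels of 1 + 1/k, hence of k/(k + 1),
hence of 1/(k + 1).  The left half starts at the vector (-1, 0), the point at
infinity. *)
Lemma fan_zero {m : projQ -> int} : markov_labelling m -> markov_fan m 0 1 1 1.
Proof.
move=> hm; have [m01 m11] := (markov_at_zero hm, markov_at_one hm).
apply: (mirror_fan (fun k : nat => markov_at m 1 (1 + k%:Z))) => //.
- by rewrite m01.
- by move=> k; rewrite mulr0 mulr1.
- move=> k; rewrite mulr0 mulr1 !addr0 subrr sub0r add0r.
  case: k => [|k].
    by rewrite addr0 m11 -(markov_0 hm) /markov_at invr0 mulr0.
  have k0 : k.+1%:Z != 0 by [].
  rewrite -(markov_at_flip hm k0) opprK markov_at_inv //; try lia.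
  rewrite [_ + 1]addrC -(@markov_at_flip m (k.+1%:Z) (1 + k.+1%:Z)) //; try lia.
  by rewrite addrK; congr markov_at; lia.
- case=> [|k]; first by rewrite addr0 m11.
  have [_] := markov_ge_den hm (farey_half_right_fan k farey_half_root).
  rewrite mulr0 mulr1 addr0 => h; apply: le_trans (le_trans h _); first by lia.
  by rewrite le_eqVlt; apply/orP; left; apply/eqP; congr markov_at; lia.
- case=> [|k].
    by rewrite addr0 m01 m11 (markov_at_third hm) (markov_at_half hm).
  have := markov_right_fan k hm farey_half_root.
  by rewrite !mulr0 !mulr1 !addr0;
    congr (markov_at _ _ _ = _ * markov_at _ _ _ - markov_at _ _ _); lia.
- by rewrite addr0 m01 m11 (markov_at_half hm).
- by rewrite addr0 m01 m11.
Qed.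

(** Here x -> 1 - x exchanges the two sides. *)
Lemma fan_half {m : projQ -> int} : markov_labelling m -> markov_fan m 1 2 1 1.
Proof.
move=> hm; have [m01 m12] := (markov_at_zero hm, markov_at_half hm).
apply: (mirror_fan (fun k : nat => markov_at m (0 + k%:Z * 1) (1 + k%:Z * 2))) => //.
- by rewrite m12.
- move=> k; have k0 : 1 + k%:Z * 2 != 0 by lia.
  by rewrite -(markov_at_flip hm k0); congr markov_at; lia.
- move=> k; have [h _] := markov_ge_den hm (farey_half_left_fan k farey_half_root).
  by apply: le_trans h; lia.
- by move=> k; apply: markov_left_fan farey_half_root.
- by rewrite mul0r !addr0 m12 m01 mul1r add0r mul1r (markov_at_third hm).
- by rewrite mul0r !addr0 m12 m01.
Qed.

(** * Monotone slopes between arbitrary rationals *)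

Definition subgradient {R : realType} (m : projQ -> int) (sg : int -> int -> R) :=
  forall a b, interior_frac a b -> supporting_slope m a b (sg a b).

Lemma subgradient_exists {R : realType} {m : projQ -> int} :
  markov_labelling m -> exists sg : int -> int -> R, subgradient m sg.
Proof.
move=> hm.
have [ab|sg sgP] := @choice (int * int) R (fun ab s =>
    interior_frac ab.1 ab.2 -> supporting_slope m ab.1 ab.2 s).
  case: (pselect (interior_frac ab.1 ab.2)) => [iab|nint]; last by exists 0.
  by have [s hs] := interior_slopes (R := R) hm iab; exists s.
by exists (fun a b => sg (a, b)) => a b; apply: (sgP (a, b)).
Qed.

Lemma interior_edge {a b c d : int} : interior_frac a b -> interior_frac c d ->
  b * c - a * d = 1 -> farey_half a b c d.
Proof. by case=> a0 ab _ [c0 cd _] det; split; lia. Qed.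

(** A right neighbour e/g of a/b that lies between a/b and c/d and is closer to c/d:
adding a/b to e/g changes the determinant of e/g with c/d by that of a/b with c/d,
so the former can be reduced modulo the latter. *)
Lemma farey_between {a b c d : int} :
  interior_frac a b -> interior_frac c d -> 1 < b * c - a * d ->
  exists e g i : int, [/\ interior_frac e g, farey_half a b e g, 0 < i,
    i < b * c - a * d & g * c - e * d = i].
Proof.
move=> [a0 ab cab] [c0 cd ccd] D1; set D := b * c - a * d in D1 *.
have [u [v uv]] : exists u v : int, u * b + v * a = 1.
  have [u [v uv]] := Bezoutz b a; exists u, v.
  by rewrite uv; apply/eqP; rewrite gcdzC; move: cab; rewrite -coprimezE.
(* the right neighbours of a/b are (u + k a) / (- v + k b) *)
pose j := - v * c - u * d; pose k := - (j %/ D)%Z; pose i := (j %% D)%Z.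
pose e := u + k * a; pose g := - v + k * b.
have det : b * e - a * g = 1 by rewrite -uv /e /g; ring.
have iE : g * c - e * d = i.
  have -> : i = j - (j %/ D)%Z * D.
    by apply/esym/eqP; rewrite subr_eq addrC -divz_eq.
  by rewrite /e /g /k /j /D; ring.
have iD : i < D by rewrite ltz_pmod //; lia.
have i0 : 0 <= i by rewrite modz_ge0 //; lia.
have eD : D * e = c + i * a.
  transitivity (c * (b * e - a * g) + (g * c - e * d) * a); first by rewrite /D; ring.
  by rewrite det mulr1 iE.
have gD : D * g = d + i * b.
  transitivity (d * (b * e - a * g) + (g * c - e * d) * b); first by rewrite /D; ring.
  by rewrite det mulr1 iE.
(* otherwise D divides both c and d *)
have {}i0 : 0 < i.
  rewrite lt_neqAle i0 andbT eq_sym; apply/eqP => i0'.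
  rewrite i0' mul0r addr0 in eD; rewrite i0' mul0r addr0 in gD.
  have : (`|D| %| gcdn `|c| `|d|)%N.
    by rewrite dvdn_gcd -eD -gD !abszM !dvdn_mulr.
  by move: ccd; rewrite /coprime => /eqP ->; rewrite dvdn1; lia.
have D0 : 0 < D by apply: lt_trans D1.
have e0 : 0 < e by rewrite -(pmulr_rgt0 _ D0) eD addr_gt0 ?mulr_gt0.
have eg : 2 * e < g.
  rewrite -subr_gt0 -(pmulr_rgt0 _ D0).
  have -> : D * (g - 2 * e) = (d - 2 * c) + i * (b - 2 * a).
    by rewrite mulrBr gD mulrCA eD; ring.
  by rewrite addr_gt0 // ?mulr_gt0 // subr_gt0.
have int : interior_frac e g.
  by split=> //; apply: (@coprime_of_det b (- a)); rewrite -det; ring.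
by exists e, g, i; split=> //; apply: interior_edge.
Qed.

(** Convexity of psi on the rationals: by induction on the determinant, the slope
from a/b to c/d is a weighted mean of the slopes from a/b to e/g and from e/g to
c/d, both of which are compared with sg e g. *)
Lemma slope_between {R : realType} {m : projQ -> int} {sg : int -> int -> R}
    {a b c d : int} :
  subgradient m sg -> interior_frac a b -> interior_frac c d -> 0 < b * c - a * d ->
  (b * c - a * d)%:~R * sg a b <= edge_slope R m a b c d /\
  edge_slope R m a b c d <= (b * c - a * d)%:~R * sg c d.
Proof.
move=> hsg; have [n] : exists n : nat, b * c - a * d <= n%:Z.
  by exists (absz (b * c - a * d)%R); lia.
elim: n a b c d => [|n IHn] a b c d Dn iab icd D0; first lia.
have [D1|D1] := leP (b * c - a * d) 1.
  have {D1} D1 : b * c - a * d = 1 by lia.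
  have abcd := interior_edge iab icd D1.
  have [ab _ _ _] := hsg _ _ iab; have [_ cd _ _] := hsg _ _ icd.
  by rewrite D1 !mul1r ab ?cd.
have [e [g [i [ieg abeg i0 iD iE]]]] := farey_between iab icd D1.
have [_ _ _ _ det] := abeg.
have [ab _ _ _] := hsg _ _ iab; have [_ eg _ _] := hsg _ _ ieg.
have {ab} ab := ab _ _ abeg; have {eg} eg := eg _ _ abeg.
have [] := IHn e g c d _ ieg icd _; [by lia|by lia|rewrite iE => l u].
have i0R : 0 < i%:~R :> R by rewrite ltr0z.
have [a0 a2 _] := iab; have [c0 c2 _] := icd; have [e0 e2 _] := ieg.
have b0R : 0 < b%:~R :> R by rewrite ltr0z; lia.
have d0R : 0 < d%:~R :> R by rewrite ltr0z; lia.
have g0R : 0 < g%:~R :> R by rewrite ltr0z; lia.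
have slopeE : g%:~R * edge_slope R m a b c d =
    b%:~R * edge_slope R m e g c d + d%:~R * edge_slope R m a b e g.
  by rewrite /edge_slope; ring.
have DE : g%:~R * (b * c - a * d)%:~R = b%:~R * i%:~R + d%:~R :> R.
  rewrite -iE -!intrM -intrD; congr _%:~R.
  transitivity (b * (g * c - e * d) + d * (b * e - a * g)); first by ring.
  by rewrite det mulr1.
split; rewrite -(ler_pM2l g0R) mulrA DE slopeE.
- apply: le_trans (_ : b%:~R * (i%:~R * sg e g) + d%:~R * sg a b <= _).
    have : b%:~R * i%:~R * sg a b <= b%:~R * i%:~R * sg e g.
      by rewrite ler_pM2l ?mulr_gt0 //; lra.
    by lra.
  by rewrite lerD // ler_pM2l.
- apply: le_trans (_ : _ <= b%:~R * (i%:~R * sg c d) + d%:~R * sg e g) _.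
    by rewrite lerD // ler_pM2l.
  have : sg e g <= sg c d by rewrite -(ler_pM2l i0R); lra.
  by rewrite -(ler_pM2l d0R); lra.
Qed.

(** * Derivability read off difference quotients *)

Lemma ndecr_of_rat {R : realType} {f : R -> R} {l u : R} : continuous f ->
  (forall r t : rat, l < ratr r -> ratr r < ratr t :> R -> ratr t < u ->
     f (ratr r) <= f (ratr t)) ->
  forall y z, l < y -> y < z -> z < u -> f y <= f z.
Proof.
move=> fc fr y z ly yz zu; rewrite leNgt; apply/negP => fzy.
pose mid := (f y + f z) / 2.
have [e e0 ye] : exists2 e : R, 0 < e & forall t, `|y - t| < e -> mid < f t.
  have : \forall t \near y, mid < f t.
    by apply: (cvgr_gt (f y) (fc y)); rewrite /mid; lra.
  by move=> /nbhs_ballP [e e0 ye]; exists e => // t ty; apply: ye.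
have [e' e'0 ze] : exists2 e : R, 0 < e & forall t, `|z - t| < e -> f t < mid.
  have : \forall t \near z, f t < mid.
    by apply: (cvgr_lt (f z) (fc z)); rewrite /mid; lra.
  by move=> /nbhs_ballP [e' e'0 ze]; exists e' => // t ty; apply: ze.
have [r] : exists r : rat, ratr r \in `]y, (Num.min (y + e) ((y + z) / 2))[.
  by apply: rat_in_itvoo; rewrite lt_min; apply/andP; split; lra.
rewrite in_itv /= lt_min => /and3P [yr re rm].
have [t] : exists t : rat, ratr t \in `](Num.max (z - e') ((y + z) / 2)), z[.
  by apply: rat_in_itvoo; rewrite gt_max; apply/andP; split; lra.
rewrite in_itv /= gt_max => /andP [/andP [te tm] tz].
have fr1 : mid < f (ratr r) by apply: ye; rewrite distrC gtr0_norm; lra.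
have ft1 : f (ratr t) < mid by apply: ze; rewrite gtr0_norm; lra.
have := fr r t; lra.
Qed.

(** The bounds p make the difference quotients at x a Cauchy filter, so that the
derivative itself never has to be named. *)
Lemma derivable_of_slopes {R : realType} {f : R -> R} {x : R} :
  (forall e, 0 < e -> exists p l u : R, [/\ l < x, x < u &
     forall y z, l < y -> y < z -> z < u ->
       p * (z - y) <= f z - f y /\ f z - f y <= (p + e) * (z - y)]) ->
  derivable f x 1.
Proof.
move=> slopes; rewrite /derivable; apply: cauchy_cvg; apply: cauchy_exP => e e0.
have [|p [l [u [lx xu H]]]] := slopes (e / 2); first by lra.
exists p; rewrite /ball /=.
have d0 : 0 < Num.min (x - l) (u - x) by rewrite lt_min; apply/andP; split; lra.
exists (Num.min (x - l) (u - x)) => //= h /=; rewrite sub0r normrN => hd hn0.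
move: hd; rewrite lt_min !ltr_norml => /andP [/andP [hl _] /andP [_ hu]].
rewrite [h *: 1]mulr1 -[_ *: _]/(h^-1 * _).
have [h0|h0|h0] := ltgtP h 0; last by rewrite h0 eqxx in hn0.
- have [] := H (h + x) x; [lra|lra|lra|move=> H1 H2].
  have qE : h^-1 * (f (h + x) - f x) = (f x - f (h + x)) / (- h).
    by field; rewrite lt_eqF.
  have hN : 0 < - h by lra.
  rewrite qE; apply/andP; split.
    rewrite ltrBrDr -ltrBrDl opprK ltr_pdivrMr //; nra.
  by rewrite ltrBlDr -ltrBlDl ltr_pdivlMr //; nra.
- have [] := H x (h + x); [lra|lra|lra|move=> H1 H2].
  rewrite mulrC; apply/andP; split.
    by rewrite ltrBrDr -ltrBrDl opprK ltr_pdivrMr //; nra.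
  by rewrite ltrBlDr -ltrBlDl ltr_pdivlMr //; nra.
Qed.

Lemma not_derivable_of_kink {R : realType} {f : R -> R} {x s d : R} : 0 < d ->
  (forall e, 0 < e -> exists2 y, x < y < x + e & (s + d) * (y - x) <= f y - f x) ->
  (forall e, 0 < e -> exists2 y, x - e < y < x & f x - f y <= (s - d) * (x - y)) ->
  ~ derivable f x 1.
Proof.
move=> d0 right left /cvg_ex [D /cvgrPdist_lt /(_ d d0)] /= /nbhs_ballP [e /= e0 He].
have quot y : y != x -> `|y - x| < e -> `|D - (f y - f x) / (y - x)| < d.
  move=> yx ye; have := He (y - x).
  rewrite /ball /= sub0r normrN ye subr_eq0 yx [_ *: 1]mulr1 subrK.
  rewrite -[_ *: _]/((y - x)^-1 * _) [_^-1 * _]mulrC; exact.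
have [y /andP [xy ye] fy] := right e e0; have [z /andP [ze zx] fz] := left e e0.
have := quot y; rewrite gt_eqF // gtr0_norm ?subr_gt0 // => /(_ isT).
have := quot z; rewrite lt_eqF // ltr0_norm ?subr_lt0 // => /(_ isT).
rewrite !ltr_norml => zq yq.
have {zq} /andP [_ zq] := zq ltac:(lra); have {yq} /andP [yq _] := yq ltac:(lra).
have y1 : s + d <= (f y - f x) / (y - x) by rewrite ler_pdivlMr ?subr_gt0.
have z1 : (f z - f x) / (z - x) <= s - d.
  have -> : (f z - f x) / (z - x) = (f x - f z) / (x - z).
    by field; rewrite !subr_eq0 gt_eqF // lt_eqF.
  by rewrite ler_pdivrMr ?subr_gt0.
lra.
Qed.

(** * Irrational points and rational points of the interval from 0 to 1/2 *)

Lemma ratr_intfrac {R : realType} (a b : int) :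
  ratr (a%:~R / b%:~R) = a%:~R / b%:~R :> R.
Proof. by rewrite fmorph_div /= !ratr_int. Qed.

Lemma fock_frac {R : realType} {m : projQ -> int} {psi : R -> R} {a b : int} :
  fock_function m psi -> 0 < b -> coprime `|a| `|b| ->
  psi (a%:~R / b%:~R) = fock_at R m a b / b%:~R.
Proof.
move=> [_ psiQ] b0 ab; have := psiQ (a%:~R / b%:~R).
by rewrite ratr_intfrac (numq_frac b0 ab).2.
Qed.

Lemma frac_sub {R : realType} {a b c d : int} : 0 < b -> 0 < d ->
  c%:~R / d%:~R - a%:~R / b%:~R = (b * c - a * d)%:~R / (b%:~R * d%:~R) :> R.
Proof.
move=> b0 d0; rewrite intrB !intrM; field.
by rewrite !intr_eq0 !gt_eqF.
Qed.

Lemma fock_sub {R : realType} {m : projQ -> int} {psi : R -> R} {a b c d : int} :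
  fock_function m psi -> 0 < b -> coprime `|a| `|b| ->
  0 < d -> coprime `|c| `|d| ->
  psi (c%:~R / d%:~R) - psi (a%:~R / b%:~R) =
  edge_slope R m a b c d / (b%:~R * d%:~R).
Proof.
move=> hpsi b0 ab d0 cd; rewrite !(fock_frac hpsi) // /edge_slope; field.
by rewrite !intr_eq0 !gt_eqF.
Qed.

Lemma subgradient_slope {R : realType} {m : projQ -> int} {psi : R -> R}
    {sg : int -> int -> R} {a b c d : int} :
  fock_function m psi -> subgradient m sg ->
  interior_frac a b -> interior_frac c d ->
  a%:~R / b%:~R < c%:~R / d%:~R :> R ->
  let y : R := a%:~R / b%:~R in let z : R := c%:~R / d%:~R in
  sg a b * (z - y) <= psi z - psi y /\ psi z - psi y <= sg c d * (z - y).
Proof.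
move=> hpsi hsg iab icd lt y z; have [a0 ab cab] := iab; have [c0 cd ccd] := icd.
have b0 : 0 < b by lia.
have d0 : 0 < d by lia.
have bd0 : 0 < b%:~R * d%:~R :> R by rewrite mulr_gt0 ?ltr0z.
have D0 : 0 < b * c - a * d.
  by rewrite -(ltr0z R) -(pmulr_lgt0 _ (_ : 0 < (b%:~R * d%:~R)^-1)) ?invr_gt0 //
    -frac_sub // subr_gt0.
have [l u] := slope_between hsg iab icd D0.
rewrite (fock_sub hpsi) // frac_sub // !mulrA.
by rewrite !ler_pM2r ?invr_gt0 // [sg a b * _]mulrC [sg c d * _]mulrC.
Qed.

Lemma ratr_frac {R : realType} (r : rat) :
  ratr r = (numq r)%:~R / (denq r)%:~R :> R.
Proof. by rewrite -{1}[r]divq_num_den ratr_intfrac. Qed.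

Lemma interior_frac_ratr {R : realType} {r : rat} :
  0 < ratr r :> R -> ratr r < 1 / 2 :> R -> interior_frac (numq r) (denq r).
Proof.
move=> r0 r2; split; last exact: coprime_num_den.
  by rewrite numq_gt0 -(ltr0q R).
move: r2; rewrite ratr_frac ltr_pdivrMr ?ltr0z ?denq_gt0 // => r2.
by rewrite -(ltr_int R) intrM; lra.
Qed.

Lemma irrational_neq {R : realType} {x : R} (a b : int) :
  irrational x -> x != a%:~R / b%:~R.
Proof.
move=> xi; apply/eqP => xE; apply: xi; exists (a%:~R / b%:~R) => //.
by rewrite ratr_intfrac.
Qed.

(** For the denominator N the distance is that of N x to the integers, over N. *)
Lemma irrational_far_small_den {R : realType} {x : R} (N : nat) : irrational x ->
  exists2 delta : R, 0 < delta & forall a b : int, 0 < b -> b < N%:Z ->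
    delta <= `|x - a%:~R / b%:~R|.
Proof.
move=> xi; elim: N => [|N [delta delta0 IH]]; first by exists 1 => // a b; lia.
have [->|N0] := posnP N; first by exists 1 => // a b; lia.
have N0R : 0 < N%:R :> R by rewrite ltr0n.
pose n := Num.floor (N%:R * x).
have nx : n%:~R < N%:R * x.
  rewrite lt_neqAle floor_le andbT; apply/eqP => nE.
  have := irrational_neq n N%:Z xi; rewrite nE mulrAC mulfV ?mul1r ?eqxx //.
  by rewrite gt_eqF.
have xn : N%:R * x < n%:~R + 1 by have := floorD1_gt (N%:R * x); rewrite intrD.
pose e := Num.min (N%:R * x - n%:~R) (n%:~R + 1 - N%:R * x).
have e0 : 0 < e by rewrite lt_min !subr_gt0 nx.
exists (Num.min delta (e / N%:R)) => [|a b b0 bN].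
  by rewrite lt_min delta0 divr_gt0.
have [bN'|bN'] := ltP b N%:Z; first by rewrite ge_min IH.
have -> : b = N%:Z by lia.
rewrite ge_min; apply/orP; right; rewrite ler_pdivrMr //.
have -> : `|x - a%:~R / N%:~R| * N%:R = `|N%:R * x - a%:~R|.
  rewrite -[X in _ * X]gtr0_norm // -normrM mulrBl divfK ?gt_eqF // mulrC //.
have [an|na] := leP a n.
  have : a%:~R <= n%:~R :> R by rewrite ler_int.
  move=> an'; rewrite ge_min ger0_norm; last by lra.
  by apply/orP; left; lra.
have : (n + 1)%:~R <= a%:~R :> R by rewrite ler_int; lia.
rewrite intrD => an'; rewrite ge_min ler0_norm; last by lra.
by apply/orP; right; lra.
Qed.

Lemma farey_half_around {R : realType} {x : R} (n : nat) :
  irrational x -> 0 < x -> x < 1 / 2 ->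
  exists a b c d : int, [/\ farey_half a b c d, a%:~R / b%:~R < x,
    x < c%:~R / d%:~R & n%:Z <= b + d].
Proof.
move=> xi x0 x2; elim: n => [|n [a [b [c [d [abcd ax xc nbd]]]]]].
  by exists 0, 1, 1, 2; split=> //; rewrite ?mul0r.
have [a0 b0 d0 cd det] := abcd.
have [xm|mx|xE] := ltgtP x ((a + c)%:~R / (b + d)%:~R).
- by exists a, b, (a + c), (b + d); split=> //; [apply: farey_half_left|lia].
- by exists (a + c), (b + d), c, d; split=> //; [apply: farey_half_right|lia].
- by have := irrational_neq (a + c) (b + d) xi; rewrite xE eqxx.
Qed.

(** Descending the tree makes the gap 1/(b d) smaller than the distance from x to
every fraction with denominator less than N. *)
Lemma farey_half_around_large {R : realType} {x : R} (N : nat) :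
  irrational x -> 0 < x -> x < 1 / 2 ->
  exists a b c d : int, [/\ farey_half a b c d, a%:~R / b%:~R < x,
    x < c%:~R / d%:~R, N%:Z <= b & N%:Z <= d].
Proof.
move=> xi x0 x2; have [delta delta0 far] := irrational_far_small_den N xi.
have [a [b [c [d [abcd ax xc nbd]]]]] :=
  farey_half_around (Num.bound delta^-1).+1 xi x0 x2.
have [a0 b0 d0 cd det] := abcd.
have small : c%:~R / d%:~R - a%:~R / b%:~R < delta.
  rewrite frac_sub // det mul1r -[delta]invrK ltf_pV2 ?posrE ?mulr_gt0 ?ltr0z ?invr_gt0 //.
  apply: lt_le_trans (archi_boundP _) _; first by rewrite invr_ge0 ltW.
  by rewrite -intrM pmulrn ler_int; nia.
exists a, b, c, d; split=> //; rewrite leNgt; apply/negP => lt.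
- by have := far a b b0 lt; rewrite gtr0_norm; lra.
- by have := far c d d0 lt; rewrite ltr0_norm; lra.
Qed.

(** The slope at the left end of a Farey interval around x bounds all slopes inside
from below, and the one at the right end from above; with both denominators at
least N, the two differ by at most 2 / N. *)
Lemma derivable_irrational_interior {R : realType} {m : projQ -> int} {psi : R -> R}
    {x : R} :
  markov_labelling m -> fock_function m psi -> irrational x ->
  0 < x -> x < 1 / 2 -> derivable psi x 1.
Proof.
move=> hm hpsi xi x0 x2; have [sg hsg] := subgradient_exists (R := R) hm.
have [psic _] := hpsi.
apply: derivable_of_slopes => e e0.
(* denominators at least 3 keep both ends off 0 and 1/2 *)
pose N := (Num.bound (2 / e)).+3.
have Ne : 2 / N%:R <= e.
  have := @archi_boundP R (2 / e) ltac:(by rewrite divr_ge0 // ltW).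
  rewrite ler_pdivrMr // ltr_pdivrMr // => h; apply: (le_trans (ltW h)).
  by rewrite mulrC ler_pM2l // ler_nat; lia.
have [a [b [c [d [abcd ax xc Nb Nd]]]]] := farey_half_around_large N xi x0 x2.
have [a0 b0 d0 cd det] := abcd.
have cab := @coprime_of_det (- d) c a b ltac:(lia).
have ccd := @coprime_of_det b (- a) c d ltac:(lia).
have b3 : 3 <= b by lia.
have d3 : 3 <= d by lia.
have c1 : 1 <= c by nia.
have a1 : 0 < a.
  rewrite lt_neqAle a0 andbT; apply/eqP => aE.
  by rewrite -aE mul0r subr0 in det; nia.
have c2 : 2 * c < d.
  rewrite lt_neqAle cd andbT; apply/eqP => dE.
  have det' : c * (b - 2 * a) = 1 by rewrite -[RHS]det -dE; ring.
  have ba : 1 <= b - 2 * a by nia.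
  by nia.
have a2 : 2 * a < b by nia.
have iab : interior_frac a b by split=> //; nia.
have icd : interior_frac c d by split=> //; nia.
exists (sg a b), (a%:~R / b%:~R), (c%:~R / d%:~R); split=> //.
have slopes_close : sg c d <= sg a b + e.
  have [_ _ up _] := hsg _ _ iab; have [_ _ _ low] := hsg _ _ icd.
  have {up} up := up _ _ abcd ltac:(lia); have {low} low := low _ _ abcd ltac:(lia).
  have invN (n : int) : N%:Z <= n -> n%:~R^-1 <= N%:R^-1 :> R.
    move=> Nn; rewrite lef_pV2 ?posrE ?ltr0n // ?ltr0z; last by lia.
    by rewrite pmulrn ler_int.
  have := invN _ Nb; have := invN _ Nd; lra.
have rat_slopes (r t : rat) : a%:~R / b%:~R < ratr r :> R ->
    ratr r < ratr t :> R -> ratr t < c%:~R / d%:~R :> R ->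
    sg a b * (ratr t - ratr r) <= psi (ratr t) - psi (ratr r) /\
    psi (ratr t) - psi (ratr r) <= (sg a b + e) * (ratr t - ratr r).
  move=> ar rt tc.
  have ab0 : 0 < a%:~R / b%:~R :> R by rewrite divr_gt0 ?ltr0z.
  have cd2 : c%:~R / d%:~R < 1 / 2 :> R.
    rewrite ltr_pdivrMr ?ltr0z //; have : (2 * c)%:~R < d%:~R :> R by rewrite ltr_int.
    by rewrite intrM; lra.
  have ir := @interior_frac_ratr R r ltac:(lra) ltac:(lra).
  have it := @interior_frac_ratr R t ltac:(lra) ltac:(lra).
  rewrite !ratr_frac in ar rt tc *.
  have /= [ar1 ar2] := subgradient_slope hpsi hsg iab ir ar.
  have /= [rt1 rt2] := subgradient_slope hpsi hsg ir it rt.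
  have /= [tc1 tc2] := subgradient_slope hpsi hsg it icd tc.
  have sg_ar : sg a b <= sg (numq r) (denq r).
    by have := le_trans ar1 ar2; rewrite ler_pM2r ?subr_gt0.
  have sg_tc : sg (numq t) (denq t) <= sg c d.
    by have := le_trans tc1 tc2; rewrite ler_pM2r ?subr_gt0.
  split; [apply: le_trans rt1|apply: (le_trans rt2)];
    by rewrite ler_pM2r ?subr_gt0 // (le_trans sg_tc).
move=> y z ly yz zu.
have affc k : continuous (fun t : R => k * t).
  by move=> t; apply: cvgM; [exact: cvg_cst|exact: cvg_id].
have nd1 : psi y - sg a b * y <= psi z - sg a b * z.
  apply: (@ndecr_of_rat R (fun t => psi t - sg a b * t)) ly yz zu => [t|r t lr rt tu].
    by apply: cvgB; [exact: psic|exact: affc].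
  by have [] := rat_slopes r t lr rt tu; lra.
have nd2 : (sg a b + e) * y - psi y <= (sg a b + e) * z - psi z.
  apply: (@ndecr_of_rat R (fun t => (sg a b + e) * t - psi t)) ly yz zu
    => [t|r t lr rt tu].
    by apply: cvgB; [exact: affc|exact: psic].
  by have [] := rat_slopes r t lr rt tu; lra.
by split; lra.
Qed.

(** The neighbours of index k are at distance 1/(b (d + k b)) and
1/(b (b - d + k b)) from a/b, so they tend to a/b from either side. *)
Lemma not_derivable_fan {R : realType} {m : projQ -> int} {psi : R -> R}
    {a b c d : int} :
  fock_function m psi -> markov_fan m a b c d -> 0 < d -> d <= b ->
  ~ derivable psi (a%:~R / b%:~R) 1.
Proof.
move=> hpsi fan d0 db; have [b0 det _ _ _ _ _ _ _ _] := fan.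
have [s [delta [delta0 Rs Ls _]]] := fan_slopes (R := R) fan.
have cab := @coprime_of_det (- d) c a b ltac:(lia).
have b0R : 0 < b%:~R :> R by rewrite ltr0z.
have grow (K : nat) (n : int) : 0 <= n -> K%:Z < b * (n + K.+1%:Z * b).
  move=> n0; apply: (@lt_le_trans _ _ (n + K.+1%:Z * b)); first by nia.
  by rewrite ler_peMl; nia.
have small (e : R) : 0 < e -> exists k : nat, [/\ (0 < k)%N,
    (b%:~R * (d + k%:Z * b)%:~R)^-1 < e &
    (b%:~R * (b - d + k%:Z * b)%:~R)^-1 < e].
  move=> e0; pose K := Num.bound e^-1.
  have small_n (n : int) : 0 <= n -> (b%:~R * (n + K.+1%:Z * b)%:~R)^-1 < e.
    move=> n0; have Kn := grow K n n0.
    rewrite -[e]invrK -intrM ltf_pV2 ?posrE ?invr_gt0 ?ltr0z //; last by lia.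
    apply: lt_trans (archi_boundP _) _; first by rewrite invr_ge0 ltW.
    by rewrite pmulrn ltr_int.
  by exists K.+1; split=> //; apply: small_n; lia.
apply: (not_derivable_of_kink delta0) => e /small [k [k0 dk bk]].
- have d0' : 0 < d + k%:Z * b by nia.
  have det' : b * (c + k%:Z * a) - a * (d + k%:Z * b) = 1 by rewrite -[RHS]det; ring.
  have gap : (c + k%:Z * a)%:~R / (d + k%:Z * b)%:~R - a%:~R / b%:~R =
      (b%:~R * (d + k%:Z * b)%:~R)^-1 :> R by rewrite frac_sub // det' mul1r.
  exists ((c + k%:Z * a)%:~R / (d + k%:Z * b)%:~R).
    apply/andP; split; last by rewrite -ltrBlDl gap.
    by rewrite -subr_gt0 gap invr_gt0 mulr_gt0 // ltr0z.
  rewrite (fock_sub hpsi) //; last by apply: (@coprime_of_det b (- a)); lia.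
  by rewrite frac_sub // det' mulrA mulr1 ler_pM2r // invr_gt0 mulr_gt0 ?ltr0z.
- have d0' : 0 < b - d + k%:Z * b by nia.
  have det' : (b - d + k%:Z * b) * a - (a - c + k%:Z * a) * b = 1.
    by rewrite -[RHS]det; ring.
  have sub0 : 0 < (b - d + k%:Z * b)%:~R * b%:~R :> R by rewrite mulr_gt0 ?ltr0z.
  have gap : a%:~R / b%:~R - (a - c + k%:Z * a)%:~R / (b - d + k%:Z * b)%:~R =
      (b%:~R * (b - d + k%:Z * b)%:~R)^-1 :> R.
    by rewrite frac_sub // det' mul1r mulrC.
  exists ((a - c + k%:Z * a)%:~R / (b - d + k%:Z * b)%:~R).
    apply/andP; split; first by rewrite ltrBlDr -ltrBlDl gap.
    by rewrite -subr_gt0 gap mulrC invr_gt0.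
  rewrite (fock_sub hpsi) //; last by apply: (@coprime_of_det (- b) a); lia.
  by rewrite frac_sub // det' mulrA mulr1 ler_pM2r // invr_gt0.
Qed.

Lemma not_derivable_interior {R : realType} {m : projQ -> int} {psi : R -> R}
    {a b : int} :
  markov_labelling m -> fock_function m psi -> interior_frac a b ->
  ~ derivable psi (a%:~R / b%:~R) 1.
Proof.
move=> hm hpsi iab; have [c [d [LR AR LA]]] := farey_parents iab.
apply: (not_derivable_fan hpsi (interior_fan hm LR AR LA)).
  by case: AR.
by have [_ b1 _ _ _] := LR; lia.
Qed.

(** * Symmetries and reduction to the interval from 0 to 1/2 *)

Lemma eq_of_rat {R : realType} {f g : R -> R} {l x : R} : l < x ->
  {for x, continuous f} -> {for x, continuous g} ->
  (forall r : rat, l < ratr r -> f (ratr r) = g (ratr r)) -> f x = g x.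
Proof.
move=> lx fc gc fg; apply/eqP; rewrite -subr_eq0; apply/negPn/negP => neq.
have fgc : {for x, continuous (fun t => f t - g t)} by apply: cvgB.
have : \forall t \near x, f t - g t != 0 by exact: cvgr_neq0 fgc neq.
move=> /nbhs_ballP [e /= e0 He].
have [r] : exists r : rat, ratr r \in `]x, (x + e)[.
  by apply: rat_in_itvoo; rewrite ltrDl.
rewrite in_itv /= => /andP [xr re].
have := He (ratr r); rewrite /ball /= ltr0_norm; last by lra.
by rewrite fg ?subrr ?eqxx //; last lra; move/(_ ltac:(lra)).
Qed.

Lemma derivable1_comp {R : realType} {f g : R -> R} {x : R} :
  derivable f (g x) 1 -> derivable g x 1 -> derivable (f \o g) x 1.
Proof.
move=> /derivable1_diffP df /derivable1_diffP dg.
by apply/derivable1_diffP; apply: differentiable_comp.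
Qed.

Lemma fock_flip {R : realType} {m : projQ -> int} {psi : R -> R} (x : R) :
  markov_labelling m -> fock_function m psi -> psi (1 - x) = psi x.
Proof.
move=> hm [psic psiQ].
have flipc : {for x, continuous (fun t : R => 1 - t)}.
  by apply: cvgB; [exact: cvg_cst|exact: cvg_id].
apply: (@eq_of_rat R (fun t => psi (1 - t)) psi (x - 1)); rewrite ?ltrBlDr ?ltrDl //.
- by apply: continuous_comp flipc _; apply: psic.
- exact: psic.
move=> r _; have <- : ratr (1 - r) = 1 - ratr r :> R by rewrite rmorphB rmorph1.
rewrite !psiQ -(markov_flip hm (Some r)); congr (_ / _%:~R).
have cop : coprime `|denq r - numq r| `|denq r|.
  move: (coprime_num_den r); rewrite -coprimezE => /coprimezP [[u v] /= uv].
  by apply: (@coprime_of_det (- u) (u + v)); rewrite -[RHS]uv; ring.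
have := (numq_frac (denq_gt0 r) cop).2.
by rewrite intrB mulrBl divff ?intr_eq0 ?denq_neq0 // divq_num_den.
Qed.

(** The label of 1/r is that of r, while its denominator is the numerator of r. *)
Lemma fock_inv {R : realType} {m : projQ -> int} {psi : R -> R} (x : R) :
  markov_labelling m -> fock_function m psi -> 0 < x -> x * psi x^-1 = psi x.
Proof.
move=> hm [psic psiQ] x0.
have invc : {for x, continuous (fun t : R => t^-1)}.
  by apply: inv_continuous; rewrite gt_eqF.
apply: (@eq_of_rat R (fun t => t * psi t^-1) psi 0) => //.
- by apply: cvgM; [exact: cvg_id|apply: continuous_comp invc _; apply: psic].
- exact: psic.
move=> r; rewrite ltr0q => r0; rewrite -fmorphV !psiQ.
have n0 : 0 < numq r by rewrite numq_gt0.
have -> : m (Some r^-1) = m (Some r).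
  by rewrite -[RHS](markov_inv hm) /projQ_inv gt_eqF.
have cop : coprime `|denq r| `|numq r| by rewrite coprime_sym coprime_num_den.
have -> : denq r^-1 = numq r.
  by have := (numq_frac n0 cop).2; rewrite -[in X in X -> _]invf_div divq_num_den.
rewrite ratr_frac; field.
by rewrite !intr_eq0 denq_neq0 gt_eqF.
Qed.

Lemma fundamental_domain {R : realType} (P : R -> Prop) :
  (forall x, 0 <= x -> x <= 1 / 2 -> P x) ->
  (forall x, P (1 - x) -> P x) ->
  (forall x, 0 < x -> P x^-1 -> P x) -> forall x, P x.
Proof.
move=> dom flip inv.
have P01 x : 0 <= x -> x <= 1 -> P x.
  move=> x0 x1; have [x2|x2] := leP x (1 / 2); first exact: dom.
  by apply/flip/dom; lra.
have Ppos x : 0 <= x -> P x.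
  move=> x0; have [x1|x1] := leP x 1; first exact: P01.
  have xp : 0 < x by lra.
  by apply: inv => //; apply: P01; rewrite ?invr_ge0 // invf_le1 // ltW.
move=> x; have [x0|x0] := leP 0 x; first exact: Ppos.
by apply/flip/Ppos; lra.
Qed.

Lemma rational_flip {R : realType} {x : R} : rational x -> rational (1 - x).
Proof. by case=> r _ <-; exists (1 - r) => //; rewrite rmorphB rmorph1. Qed.

Lemma rational_inv {R : realType} {x : R} : rational x -> rational x^-1.
Proof. by case=> r _ <-; exists r^-1 => //; rewrite fmorphV. Qed.

Lemma derivable_flip {R : realType} {m : projQ -> int} {psi : R -> R} {x : R} :
  markov_labelling m -> fock_function m psi ->
  derivable psi (1 - x) 1 -> derivable psi x 1.
Proof.
move=> hm hpsi dpsi.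
have -> : psi = psi \o (fun t => 1 - t).
  by apply/funext => t; rewrite /= (fock_flip t hm hpsi).
have dflip : derivable (fun t : R => 1 - t) x 1.
  by apply: derivableB; [exact: derivable_cst|exact: derivable_id].
exact: (@derivable1_comp R psi (fun t => 1 - t) x dpsi dflip).
Qed.

Lemma derivable_inv {R : realType} {m : projQ -> int} {psi : R -> R} {x : R} :
  markov_labelling m -> fock_function m psi -> 0 < x ->
  derivable psi x^-1 1 -> derivable psi x 1.
Proof.
move=> hm hpsi x0 dpsi.
have eqx : {near x, (fun t => t * psi t^-1) =1 psi}.
  near=> t; apply: (fock_inv t hm hpsi); near: t.
  exact: lt_nbhsr.
have dinv : derivable (fun t : R => t^-1) x 1.
  by apply: derivableV; [exact: lt0r_neq0|exact: derivable_id].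
have dcomp := @derivable1_comp R psi (fun t : R => t^-1) x dpsi dinv.
apply: (near_eq_derivable eqx).
exact: (@derivableM R R id _ x 1 (@derivable_id R R x 1) dcomp).
Unshelve. all: by end_near.
Qed.

Theorem theorem2 (R : realType) (m : projQ -> int) (psi : R -> R)
  (hm : markov_labelling m) (hpsi : fock_function m psi) :
  (forall x : R, irrational x -> derivable psi x 1) /\
  (forall x : R, rational x -> ~ derivable psi x 1).
Proof.
suff H (x : R) : (irrational x -> derivable psi x 1) /\
    (rational x -> ~ derivable psi x 1).
  by split=> x; have [] := H x.
apply: (fundamental_domain (fun x => (irrational x -> derivable psi x 1) /\
    (rational x -> ~ derivable psi x 1))) x => [x x0 x2|x [Hi Hr]|x x0 [Hi Hr]].
- split=> [xi|[r _ rx]].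
    apply: (derivable_irrational_interior hm hpsi xi).
      rewrite lt_neqAle x0 andbT eq_sym.
      by have := irrational_neq 0 1 xi; rewrite mulr0z mul0r.
    rewrite lt_neqAle x2 andbT; exact: (irrational_neq 1 2 xi).
  move: x0; rewrite le_eqVlt => /orP [/eqP x0|x0].
    have := not_derivable_fan hpsi (fan_zero hm) isT isT.
    by rewrite mulr0z mul0r x0.
  move: x2; rewrite le_eqVlt => /orP [/eqP ->|x2].
    exact: (not_derivable_fan hpsi (fan_half hm) isT isT).
  rewrite -rx in x0 x2 *; rewrite ratr_frac.
  exact: (not_derivable_interior hm hpsi (interior_frac_ratr x0 x2)).
- split=> [xi|xr dx].
    apply: (derivable_flip hm hpsi); apply: Hi => xr; apply: xi.
    by rewrite -[x](subKr 1); apply: rational_flip.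
  apply: (Hr (rational_flip xr)); apply: (derivable_flip hm hpsi).
  by rewrite subKr.
- split=> [xi|xr dx].
    apply: (derivable_inv hm hpsi x0); apply: Hi => xr; apply: xi.
    by rewrite -[x]invrK; apply: rational_inv.
  apply: (Hr (rational_inv xr)); apply: (derivable_inv hm hpsi).
    by rewrite invr_gt0.
  by rewrite invrK.
Qed.
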